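(* Let $x_0>0$, $z_0$, $k_1$, $k_2$ be real numbers with $x_0^2+z_0^2=1$ and $k_2<K_0<k_1$, where $K_0=z_0/x_0$. Let $\mathfrak{C}_{K_0,k_1,k_2}$ be the class of continuous concave functions $u:[0,x_0]\to\mathbb{R}$ such that $u(0)=0$, $u(x_0)=z_0$ and $k_2\le u'(x)\le k_1$ (at every $x$ where the derivative exists). Then the problem of minimizing $$\int_0^{x_0}\frac{1}{1+u'^2(x)}\,dx$$ in the class $\mathfrak{C}_{K_0,k_1,k_2}$ has a unique solution $u$, and it is described as follows. (i) Let $-\sqrt{1+k_1^2}\le k_1+k_2\le\sqrt{1+k_2^2}$. Then $u'(x)$ takes two values, $k_1$ and $k_2$, and therefore $u(x)=\min\{k_1x,\ z_0+k_2(x-x_0)\}$, and the graph of $u$ is the broken line $ACB$. (ii) Let $k_1\le-1/\sqrt3$ or $k_2\ge1/\sqrt3$. Then $u(x)=K_0x$, and therefore the graph of $u$ is the segment $AB$. (iii) Let $k_2<1/\sqrt3$ and $k_1>\sqrt{1+k_2^2}-k_2$. Then (a) if $k_2<K_0<\sqrt{1+k_2^2}-k_2$, then $u'(x)$ takes two values, $k_2$ and $\sqrt{1+k_2^2}-k_2$, and the graph of $u$ is the broken line $AC''B$, where $C''$ is a point on $CB$; (b) if $\sqrt{1+k_2^2}-k_2\le K_0<k_1$, then $u(x)=K_0x$. (iv) Let $k_1>-1/\sqrt3$ and $k_2<-\sqrt{1+k_1^2}-k_1$. Then (a) if $-\sqrt{1+k_1^2}-k_1<K_0<k_1$, then $u'(x)$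 takes the two values $k_1$ and $-\sqrt{1+k_1^2}-k_1$, and the graph of $u$ is the broken line $AC'B$, where $C'$ is a point on $AC$; (b) if $k_2<K_0\le-\sqrt{1+k_1^2}-k_1$, then $u(x)=K_0x$.
   Context: $A=(0,0)$, $B=(x_0,z_0)$, and $C$ is the third vertex of the triangle $ABC$ in the $(x,z)$-plane whose side $AC$ has slope $k_1$ and whose side $BC$ has slope $k_2$, i.e. $C$ is the intersection of the lines $z=k_1x$ and $z=z_0+k_2(x-x_0)$. ''$u'$ takes two values'' means that $u$ is piecewise linear with one breakpoint and its derivative equals one value to the left and the other value to the right of the breakpoint (since $u$ is concave, the larger value is on the left). *)

(* Defs.v *)
From HB Require Import structures.
From mathcomp Require Import all_boot all_order all_algebra.
From mathcomp Require Import all_classical all_reals all_analysis.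

Set Implicit Arguments.
Unset Strict Implicit.
Unset Printing Implicit Defensive.

Import Order.TTheory GRing.Theory Num.Theory.
Import numFieldNormedType.Exports.

Local Open Scope classical_set_scope.
Local Open Scope ring_scope.

(* A function on [a, b] is represented by a total function R -> R of which only
   the values on [a, b] matter. *)
Definition concave_on (R : realType) (a b : R) (u : R -> R) : Prop :=
  @convex_function R R^o [set` `[a, b]] (fun x => - u x).

(* The slope bounds are imposed at the interior points of differentiability,
   because a two-sided derivative at 0 or x0 would depend on the values of u
   outside [0, x0].  The one-sided endpoint derivatives, when they exist, are
   limits of slopes at interior points and so obey the same bounds. *)
Definition adm_class (R : realType) (x0 z0 k1 k2 : R) : set (R -> R) :=
  [set u : R -> R | [/\ {within `[0, x0], continuous u},
               concave_on 0 x0 u,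
               u 0 = 0,
               u x0 = z0 &
               forall x, 0 < x < x0 -> derivable u x 1 ->
                 k2 <= derive1 u x <= k1]].

(* A concave u fails to be differentiable at countably many points at most, so
   the value of derive1 u at those points does not affect the integral. *)
Definition resistance (R : realType) (x0 : R) (u : R -> R) : \bar R :=
  (\int[lebesgue_measure]_(x in `[0%R, x0]) ((1 + derive1 u x ^+ 2)^-1)%:E)%E.

Definition is_solution (R : realType) (x0 z0 k1 k2 : R) (u : R -> R) : Prop :=
  adm_class x0 z0 k1 k2 u /\
  forall v, adm_class x0 z0 k1 k2 v ->
    (resistance x0 u <= resistance x0 v)%E.

(* "u' takes two values", p to the left and q < p to the right of the single
   breakpoint c of the piecewise linear function u. *)
Definition two_slopes (R : realType) (x0 : R) (u : R -> R) (p q : R) : Prop :=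
  q < p /\
  exists c : R,
    [/\ 0 < c < x0,
        exists a b : R, forall x, x \in `[0, c] -> u x = a + b * x,
        exists a b : R, forall x, x \in `[c, x0] -> u x = a + b * x,
        forall x, 0 < x < c -> is_derive x 1 u p &
        forall x, c < x < x0 -> is_derive x 1 u q].

Definition graph_on (R : realType) (x0 : R) (u : R -> R) : set (R * R) :=
  [set (x, u x) | x in `[0, x0]].

Definition segment (R : realType) (P Q : R * R) : set (R * R) :=
  [set ((1 - t) * P.1 + t * Q.1, (1 - t) * P.2 + t * Q.2) | t in `[0, 1]].

Definition broken_line (R : realType) (P Q S : R * R) : set (R * R) :=
  segment P Q `|` segment Q S.

(* Main.v *)
(* Write f(t) = 1 / (1 + t^2).  If an affine function l lies below f on [k2, k1],
   then for every admissible u the integral of f(u') is at least the integral of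
   l(u'), which depends only on the boundary values of u; equality forces u' to
   lie almost everywhere in the contact set {f = l}.  In each case l is a chord of
   f or the tangent at K0, and on [k2, k1] it touches f at two slopes p > q with
   q <= K0 <= p (one of which may be irrelevant when K0 is the other).  Since u'
   is nonincreasing, u' in {p, q} determines u as min (p x, z0 + q (x - x0)).
   A concave u is handled through a nonincreasing selection d of supergradients:
   u' = d off a countable set, and u is the integral of d. *)
Require Import Defs.
From HB Require Import structures.
From mathcomp Require Import all_boot all_order all_algebra.
From mathcomp Require Import all_classical all_reals all_analysis.
From mathcomp Require Import measurable_realfun ring lra.

Set Implicit Arguments.
Unset Strict Implicit.
Unset Printing Implicit Defensive.

Import Order.TTheory GRing.Theory Num.Theory.
Import numFieldNormedType.Exports.

Local Open Scope classical_set_scope.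
Local Open Scope ring_scope.

(** * Supergradients of concave functions *)

(** Only pairs [x < y] are compared, so at [a] the value of [d] bounds the slopes to the right from
    above and at [b] it bounds the slopes to the left from below; one-sided information is enough at
    the endpoints. *)
Definition supergradient_on (R : realType) (a b : R) (u d : R -> R) : Prop :=
  forall x y, a <= x -> x < y -> y <= b ->
    d y * (y - x) <= u y - u x <= d x * (y - x).

(** Three-chord inequality: [y] is the convex combination of [x] and [z] in which [x] has weight
    [(z - y) / (z - x)]; multiplying the concavity inequality by [z - x] clears the denominators. *)
Lemma concave_on_slopes (R : realType) (a b : R) (u : R -> R) (x y z : R) :
  concave_on a b u -> a <= x -> x < y -> y < z -> z <= b ->
  (u z - u y) / (z - y) <= (u y - u x) / (y - x).
Proof.
move=> cu ax xy yz zb.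
have zx : 0 < z - x by lra.
have xz_gt0 : 0 <= (z - y) / (z - x) by rewrite divr_ge0//; lra.
have xz_lt1 : (z - y) / (z - x) <= 1 by rewrite ler_pdivrMr// mul1r; lra.
have xab : x \in [set` `[a, b]] by rewrite inE/= in_itv/=; lra.
have zab : z \in [set` `[a, b]] by rewrite inE/= in_itv/=; lra.
have := cu (Itv01 xz_gt0 xz_lt1) x z xab zab.
set t := Itv01 _ _.
have -> : conv t (x : convex_lmodType R^o) z = y.
  rewrite /conv/= /unstable.onem.
  have -> : (z - y) / (z - x) *: (x : R^o) + (1 - (z - y) / (z - x)) *: (z : R^o)
    = (z - y) / (z - x) * x + (1 - (z - y) / (z - x)) * z by [].
  by field; rewrite gt_eqF.
rewrite convRE/= /unstable.onem => h.
rewrite ler_pdivrMr ?subr_gt0// mulrAC ler_pdivlMr ?subr_gt0//.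
have : 0 <= (z - x) * (u y - ((z - y) / (z - x) * u x + (1 - (z - y) / (z - x)) * u z)).
  by apply: mulr_ge0; lra.
have -> : (z - x) * (u y - ((z - y) / (z - x) * u x + (1 - (z - y) / (z - x)) * u z))
   = (z - x) * u y - (z - y) * u x - (y - x) * u z.
  by field; rewrite gt_eqF.
by lra.
Qed.

Lemma supergradient_nonincreasing (R : realType) (a b : R) (u d : R -> R) :
  supergradient_on a b u d ->
  forall x y, a <= x -> x <= y -> y <= b -> d y <= d x.
Proof.
move=> sd x y ax; rewrite le_eqVlt => /predU1P[->//|xy yb].
have /andP[h1 h2] := sd _ _ ax xy yb.
by rewrite -(ler_pM2r (x := y - x)) ?subr_gt0// (le_trans h1).
Qed.

Lemma is_derive_slopeP (R : realType) (u : R -> R) (x l : R) :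
  (forall e, 0 < e -> exists2 r, 0 < r & forall y, y != x -> `|y - x| < r ->
     `|l - (u y - u x) / (y - x)| <= e) ->
  is_derive x 1 u l.
Proof.
move=> H.
have : h^-1 *: ((u \o shift x) (h *: (1 : R)) - u x) @[h --> 0^'] --> l.
  apply/cvgrPdist_le => e e0; have [r r0 Hr] := H _ e0.
  near=> h.
  have h0 : h != 0 by near: h; exact: nbhs_dnbhs_neq.
  have hr : `|h| < r by near: h; exact: dnbhs0_lt.
  have := Hr (h + x); rewrite addrK -subr_eq0 addrK => /(_ h0 hr).
  by rewrite /= [h *: 1]mulr1 /shift/= [_ *: _]mulrC.
move=> c; apply: DeriveDef; first by apply/cvg_ex; exists l.
exact: cvg_lim.
Unshelve. all: by end_near. Qed.

(** The slope between [x] and [y] lies between [d x] and [d y], so its distance to [d x] is at most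
    the distance from [d x] to [d y], which continuity makes small. *)
Lemma supergradient_continuous_is_derive (R : realType) (a b : R) (u d : R -> R)
    (x : R) :
  supergradient_on a b u d -> a < x < b -> {for x, continuous d} ->
  is_derive x 1 u (d x).
Proof.
move=> sd /andP[ax xb] /cvgrPdist_le cd.
apply: is_derive_slopeP => e e0.
have /nbhs_normP[r /= r0 Hr] := cd _ e0.
exists (Num.min r (Num.min (x - a) (b - x))).
  by rewrite !lt_min r0/= !subr_gt0 ax.
move=> y yx; rewrite !lt_min => /andP[yr /andP[ya yb]].
have /= := Hr y; rewrite distrC => /(_ yr) {}Hr; apply: le_trans Hr.
move: yx; rewrite neq_lt => /orP[yx|xy].
- rewrite ltr0_norm ?subr_lt0// in ya yb.
  have := sd y x; move=> /(_ ltac:(lra) yx ltac:(lra))/andP[h1 h2].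
  have -> : (u y - u x) / (y - x) = (u x - u y) / (x - y).
    by rewrite -(opprB (u x)) -(opprB x) invrN mulrNN.
  rewrite distrC -(distrC (d y)) !ger0_norm ?subr_ge0//; last first.
  + by rewrite ler_pdivlMr// subr_gt0.
  + by rewrite (supergradient_nonincreasing sd)//; lra.
  + by rewrite lerD2r ler_pdivrMr// subr_gt0.
- rewrite gtr0_norm ?subr_gt0// in ya yb.
  have := sd x y; move=> /(_ ltac:(lra) xy ltac:(lra))/andP[h1 h2].
  rewrite !ger0_norm ?subr_ge0//; last first.
  + by rewrite ler_pdivrMr// subr_gt0.
  + by rewrite (supergradient_nonincreasing sd)//; lra.
  + by rewrite lerD2l lerN2 ler_pdivlMr// subr_gt0.
Qed.

(** Monotonicity makes both one-sided limits exist and places [f x] between them; the negation of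
    [discontinuity] says that the two limits agree. *)
Lemma nondecreasing_continuity_pt (R : realType) (a b : R) (f : R -> R) (x : R) :
  {in `[a, b] &, {homo f : n m / n <= m}} -> a < x < b ->
  ~ discontinuity f x -> {for x, continuous f}.
Proof.
move=> nf /andP[ax xb] ndx.
have Hf y z : a <= y -> y <= z -> z <= b -> f y <= f z.
  by move=> ? ? ?; apply: nf; rewrite ?in_itv/=; lra.
have cl : cvg (f t @[t --> x^'-]).
  apply: nondecreasing_at_left_is_cvgr.
    near=> t.
    have at_ : a < t by near: t; exact: nbhs_left_gt.
    move=> y z; rewrite !in_itv/= => /andP[ty yx] /andP[tz zx] yz.
    by apply: Hf; lra.
  near=> t; have at_ : a < t by near: t; exact: nbhs_left_gt.
  exists (f x) => _ [y /= + <-]; rewrite in_itv/= => /andP[ty yx].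
  by apply: Hf; lra.
have cr : cvg (f t @[t --> x^'+]).
  apply: nondecreasing_at_right_is_cvgr.
    near=> t.
    have tb : t < b by near: t; exact: nbhs_right_lt.
    move=> y z; rewrite !in_itv/= => /andP[ty yx] /andP[tz zx] yz.
    by apply: Hf; lra.
  near=> t; have tb : t < b by near: t; exact: nbhs_right_lt.
  exists (f x) => _ [y /= + <-]; rewrite in_itv/= => /andP[ty yx].
  by apply: Hf; lra.
have e : lim (f t @[t --> x^'-]) = lim (f t @[t --> x^'+]).
  by apply/eqP/negP => /negP h; apply: ndx.
have l1 : lim (f t @[t --> x^'-]) <= f x.
  apply: limr_le => //; near=> t.
  have tx : t < x by near: t; exact: nbhs_left_lt.
  have at_ : a < t by near: t; exact: nbhs_left_gt.
  by apply: Hf; lra.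
have l2 : f x <= lim (f t @[t --> x^'+]).
  apply: limr_ge => //; near=> t.
  have tx : x < t by near: t; exact: nbhs_right_gt.
  have tb : t < b by near: t; exact: nbhs_right_lt.
  by apply: Hf; lra.
apply/left_right_continuousP.
have -> : f x = lim (f t @[t --> x^'-]) by apply/le_anti; rewrite l1 e l2.
by split=> //; rewrite e.
Unshelve. all: by end_near. Qed.

(** A monotone function has countably many discontinuities, and [u] has derivative [d x] wherever
    [d] is continuous. The countability result is applied to [- d], which is nondecreasing. *)
Lemma supergradient_countable (R : realType) (a b : R) (u d : R -> R) :
  supergradient_on a b u d ->
  countable [set x | x \in (`]a, b[) /\ ~ is_derive x 1 u (d x)].
Proof.
move=> sd.
have nd : {in `[a, b] &, {homo - d : n m / n <= m}}.
  move=> x y; rewrite !in_itv/= => /andP[ax xb] /andP[ay yb] xy.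
  by rewrite !fctE lerN2; exact: (supergradient_nonincreasing sd).
apply: sub_countable (discontinuity_countable nd).
apply: subset_card_le => x/= [xab nx]; split=> //.
apply: contrapT => /(nondecreasing_continuity_pt nd) cx; apply: nx.
move: xab; rewrite in_itv/= => xab.
apply: (supergradient_continuous_is_derive sd) => //.
have <- : (fun t => - (- d) t) = d by apply/funext => t; rewrite !fctE opprK.
exact: continuousN (cx xab).
Qed.

(** The witness is the left derivative, written as an infimum of left slopes. The side conditions
    guard the endpoints: at [a] the set of slopes is empty, at [b] it may be unbounded below, and
    [inf] is then only a default value. *)
Lemma concave_on_supergradient (R : realType) (a b : R) (u : R -> R) :
  concave_on a b u ->
  exists d : R -> R, forall x y, a <= x -> x < y -> y <= b ->
    (y < b -> d y * (y - x) <= u y - u x) /\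
    (a < x -> u y - u x <= d x * (y - x)).
Proof.
move=> cu; pose S x := [set (u x - u s) / (x - s) | s in `[a, x[].
have lbS x y : a < x -> x < y -> y <= b -> lbound (S x) ((u y - u x) / (y - x)).
  move=> ax xy yb _ [s /= + <-]; rewrite in_itv/= => /andP[as_ sx].
  exact: (concave_on_slopes cu).
exists (fun x => inf (S x)) => x y ax xy yb; split.
  move=> y_lt_b; rewrite -ler_pdivlMr ?subr_gt0//.
  apply: ge_inf; last by exists x => //=; rewrite in_itv/= ax.
  by exists ((u b - u y) / (b - y)); apply: lbS => //; exact: le_lt_trans ax xy.
move=> a_lt_x; rewrite -ler_pdivrMr ?subr_gt0//.
apply: lb_le_inf; last exact: lbS.
by exists ((u x - u a) / (x - a)), a => //=; rewrite in_itv/= lexx.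
Qed.

(** The exceptional set is countable, hence null, and cannot fill an interval of positive length.
    Slope bounds known for the derivative of [u] thereby pass to [d]. *)
Lemma supergradient_derivable_point (R : realType) (a b : R) (u d : R -> R) :
  a < b -> supergradient_on a b u d ->
  exists x, a < x < b /\ is_derive x 1 u (d x).
Proof.
move=> ab /supergradient_countable/countable_lebesgue_measure0 N0.
apply: contrapT => /forallNP nx.
have : lebesgue_measure [set` `]a, b[] = 0%E :> \bar R.
  rewrite -[RHS]N0; congr lebesgue_measure; apply/seteqP; split=> x /=.
    by move=> xab; split=> // dx; apply: (nx x); rewrite in_itv/= in xab.
  by case.
rewrite lebesgue_measure_itv/= lte_fin ab => /eqP.
by rewrite -EFinD eqe subr_eq0 gt_eqF.
Qed.

(** The bounds hold for [d] at points of differentiability, which are dense, and monotonicity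
    spreads them over the interior. Continuity of [u] at the ends then allows the extreme values
    [k1] and [k2] there. *)
Lemma adm_class_supergradient (R : realType) (x0 z0 k1 k2 : R) (u : R -> R) :
  0 < x0 -> k2 <= k1 -> adm_class x0 z0 k1 k2 u ->
  exists d : R -> R, [/\ supergradient_on 0 x0 u d,
    nonincreasing_fun d & forall x, k2 <= d x <= k1].
Proof.
move=> x0_gt0 k21 [cu ccu u0 ux0 du].
have [d Hd] := concave_on_supergradient ccu.
have sd a b : 0 < a -> b < x0 -> supergradient_on a b u d.
  move=> a0 bx x y ax xy yb.
  by have [|||h1 h2] := Hd x y; rewrite ?h1 ?h2//; lra.
have bd a b : 0 < a -> a < b -> b < x0 -> exists2 s, a < s < b & k2 <= d s <= k1.
  move=> a0 ab bx.
  have [s [sab ds]] := supergradient_derivable_point ab (sd _ _ a0 bx).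
  exists s => //; have := du s; rewrite derive1E (@derive_val _ _ _ _ _ _ _ ds).
  by apply; [lra|exact: ex_derive].
have mono x y : 0 < x -> x <= y -> y < x0 -> d y <= d x.
  by move=> x_gt0 xy yx; exact: (supergradient_nonincreasing (sd x y _ _)).
have dk x : 0 < x -> x < x0 -> k2 <= d x <= k1.
  move=> x_gt0 xx.
  (* A point of differentiability on each side of [x] encloses [d x] between two values that obey
     the bounds. *)
  have [||| s s1 /andP[_ s2]] := bd (x / 2) x; try lra.
  have [||| t t1 /andP[t2 _]] := bd x ((x + x0) / 2); try lra.
  have := mono s x ltac:(lra) ltac:(lra) ltac:(lra).
  have := mono x t ltac:(lra) ltac:(lra) ltac:(lra).
  by move=> ? ?; apply/andP; split; lra.
have [_ cu0 cux0] := (continuous_within_itvP _ x0_gt0).1 cu.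
(* The interior bound [u y - u t <= k1 * (y - t)] is passed to the limit as [t] tends to 0 from the
   right; [H1] does the same at [x0]. *)
have H0 y : 0 < y -> y <= x0 -> u y - k1 * y <= u 0.
  move=> y0 yx.
  have : u t - k1 * t @[t --> 0^'+] --> u 0 - k1 * 0.
    apply: cvgB => //; apply: cvgMr; apply: cvg_at_right_filter; exact: cvg_id.
  rewrite mulr0 subr0 => /cvgr_to_ge; apply; near=> t.
  have t0 : 0 < t by near: t; exact: nbhs_right_gt.
  have ty : t < y by near: t; exact: nbhs_right_lt.
  have [|||_ /(_ t0) h] := Hd t y; try lra.
  have /andP[_ dt] : k2 <= d t <= k1 by apply: dk; lra.
  have : d t * (y - t) <= k1 * (y - t) by rewrite ler_wpM2r//; lra.
  by lra.
have H1 x : 0 <= x -> x < x0 -> u x - k2 * x <= u x0 - k2 * x0.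
  move=> x_ge0 xx.
  have : u t - k2 * t @[t --> x0^'-] --> u x0 - k2 * x0.
    apply: cvgB => //; apply: cvgMr; apply: cvg_at_left_filter; exact: cvg_id.
  move=> /cvgr_to_ge; apply; near=> t.
  have tx0 : t < x0 by near: t; exact: nbhs_left_lt.
  have xt : x < t by near: t; exact: nbhs_left_gt.
  have [|||/(_ tx0) h _] := Hd x t; try lra.
  have /andP[dt _] : k2 <= d t <= k1 by apply: dk; lra.
  have : k2 * (t - x) <= d t * (t - x) by rewrite ler_wpM2r//; lra.
  by lra.
(* The constants outside []0, x0[] make [d] monotone and bounded on the whole line; at 0 and [x0]
   the supergradient inequalities are [H0] and [H1]. *)
exists (fun x => if x <= 0 then k1 else if x0 <= x then k2 else d x); split.
- move=> x y x_ge0 xy yx.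
  rewrite (leNgt y) (le_lt_trans x_ge0 xy)/= (leNgt x0 x) (lt_le_trans xy yx)/=.
  apply/andP; split.
    case: ifPn => [x0y|]; last by rewrite -ltNge => yx0; have [|||h _] := Hd x y; auto.
    have <- : x0 = y by apply/le_anti; rewrite x0y yx.
    by have := H1 x x_ge0; lra.
  case: ifPn => [xle0|]; last by rewrite -ltNge => x_gt0; have [|||_ h] := Hd x y; auto.
  have <- : 0 = x by apply/le_anti; rewrite x_ge0.
  by have := H0 y; lra.
- move=> x y xy.
  case: ifPn => [y0|]; rewrite -?ltNge.
    by rewrite (le_trans xy y0).
  move=> y0; case: ifPn => x_0; rewrite -?ltNge in x_0.
    case: ifPn => //; rewrite -ltNge => x_gt0.
    by case: ifPn => //; rewrite -ltNge => xx; have /andP[] := dk x x_gt0 xx.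
  case: ifPn => [_|]; first by have /andP[] := dk y y0 x_0.
  rewrite -ltNge => x_gt0.
  by rewrite (leNgt x0) (le_lt_trans xy x_0)/=; exact: mono.
- move=> x; case: ifPn => [_|]; first by rewrite k21 lexx.
  rewrite -ltNge => x_gt0; case: ifPn => [_|]; first by rewrite k21 lexx.
  by rewrite -ltNge => xx; exact: dk.
Unshelve. all: by end_near. Qed.

(* Summing over n equal pieces bounds |w b - w a| by (d a - d b) (b - a) / n. *)
Lemma telescope_constant (R : realType) (a b : R) (w d : R -> R) :
  a <= b ->
  (forall x y, a <= x -> x <= y -> y <= b ->
     `|w y - w x| <= (d x - d y) * (y - x)) ->
  w b = w a.
Proof.
move=> ab H.
have step n : n.+1%:R * `|w b - w a| <= (d a - d b) * (b - a).
  pose h := (b - a) / n.+1%:R.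
  have h0 : 0 <= h by rewrite divr_ge0// subr_ge0.
  have hn : n.+1%:R * h = b - a by rewrite mulrC divfK// pnatr_eq0.
  have HH k : (k <= n.+1)%N ->
      `|w (a + k%:R * h) - w a| <= (d a - d (a + k%:R * h)) * h.
    elim: k => [_|k IHk kn]; first by rewrite mul0r addr0 !subrr normr0 mul0r.
    have kb : a + k.+1%:R * h <= b.
      have : k.+1%:R * h <= n.+1%:R * h by rewrite ler_wpM2r// ler_nat.
      by lra.
    have kS : k.+1%:R * h = k%:R * h + h by rewrite -natr1 mulrDl mul1r.
    have k0 : 0 <= k%:R * h by rewrite mulr_ge0.
    have := H (a + k%:R * h) (a + k.+1%:R * h).
    move=> /(_ ltac:(lra) ltac:(lra) kb).
    have -> : a + k.+1%:R * h - (a + k%:R * h) = h by rewrite kS; ring.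
    move=> h1; have h2 := IHk (ltnW kn).
    have := ler_normD (w (a + k.+1%:R * h) - w (a + k%:R * h)) (w (a + k%:R * h) - w a).
    by rewrite addrA subrK => h3; lra.
  have := HH n.+1 (leqnn _); rewrite hn (addrC a) subrK => h1.
  by rewrite -hn mulrCA ler_wpM2l.
(* If [w b] and [w a] differed, the left side of [step] would grow without bound in [n] while the
   right side stays fixed. *)
apply/eqP; rewrite -subr_eq0 -normr_le0 leNgt; apply/negP => c0.
have C0 : 0 <= (d a - d b) * (b - a) / `|w b - w a|.
  rewrite divr_ge0 ?(ltW c0)//.
  exact: le_trans (mulr_ge0 _ _) (step 0%N).
have := archi_boundP C0; rewrite ltr_pdivrMr//.
set m := Num.bound _ => hm.
have := step m; rewrite -natr1 mulrDl mul1r; lra.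
Qed.

(** * Integrals of supergradients *)

Lemma continuous_inv1sq (R : realType) :
  continuous (fun t : R => (1 + t ^+ 2)^-1).
Proof.
move=> t; apply: cvgV; first by rewrite gt_eqF// ltr_pwDl// sqr_ge0.
by apply: cvgD; [exact: cvg_cst|exact: exprn_continuous].
Qed.

Lemma nonincreasing_comp_integrable (R : realType) (a b M : R) (d g : R -> R) :
  nonincreasing_fun d -> continuous g ->
  (forall x, x \in `[a, b] -> `|g (d x)| <= M) ->
  (@lebesgue_measure R).-integrable `[a, b] (EFin \o (g \o d)).
Proof.
move=> nd cg bg; apply: measurable_bounded_integrable => //.
- by rewrite [ltLHS]lebesgue_measure_itv/=; case: ifPn => // _; rewrite -EFinD ltry.
- apply: measurableT_comp; first exact: continuous_measurable_fun.
  exact: (nonincreasing_measurable _ nd).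
- exists M; split; first exact: num_real.
  by move=> m Mm x /= xab; rewrite (le_trans (bg x xab))// ltW.
Qed.

Lemma nonincreasing_integrable (R : realType) (a b : R) (d : R -> R) :
  nonincreasing_fun d ->
  (@lebesgue_measure R).-integrable `[a, b] (EFin \o d).
Proof.
move=> nd; apply: (@nonincreasing_comp_integrable _ _ _ (`|d a| + `|d b|) d id) => //.
  by move=> x; exact: cvg_id.
move=> x; rewrite in_itv/= => /andP[/nd h1 /nd h2].
have := ler_norm (d a); have := ler_norm (- d b).
rewrite normrN => h3 h4; rewrite ler_norml; apply/andP; split.
  by have := normr_ge0 (d a); lra.
by have := normr_ge0 (d b); lra.
Qed.

(** Over [[x, y]] the increment of [u] and the integral of [d] both lie between [d y * (y - x)] and
    [d x * (y - x)]. Their difference therefore meets the hypothesis of [telescope_constant], and no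
    differentiability of [u] is involved. *)
Lemma supergradient_integral (R : realType) (a b : R) (u d : R -> R) :
  a <= b -> supergradient_on a b u d -> nonincreasing_fun d ->
  \int[lebesgue_measure]_(x in `[a, b]) d x = u b - u a.
Proof.
move=> ab sd nd.
pose w x := u x - \int[lebesgue_measure]_(t in `[a, x]) d t.
have H x y : a <= x -> x <= y -> y <= b ->
    `|w y - w x| <= (d x - d y) * (y - x).
  move=> ax; rewrite le_eqVlt => /predU1P[->|xy] yb.
    by rewrite !subrr normr0 mul0r.
  have := @Rintegral_itvB _ d (BLeft a) (BRight y) x (nonincreasing_integrable a y nd).
  rewrite !bnd_simp => /(_ ax (ltW xy)) hI.
  have mxy : lebesgue_measure `]x, y] = (y - x)%:E.
    by rewrite lebesgue_measure_itv/= lte_fin xy.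
  have iS e : nonincreasing_fun e ->
      (@lebesgue_measure R).-integrable `]x, y] (EFin \o e).
    move=> ne; apply: (integrableS _ _ _ (nonincreasing_integrable x y ne)) => //.
    by apply: subset_itvr; rewrite bnd_simp.
  have ixy := iS _ nd; have icst c := iS (fun=> c) (fun _ _ _ => lexx c).
  have I1 : \int[lebesgue_measure]_(t in `]x, y]) d t <= d x * (y - x).
    rewrite -[y - x]/(fine (y - x)%:E) -mxy -Rintegral_cst//.
    apply: le_Rintegral => // t /=; rewrite in_itv/= => /andP[xt ty].
    exact/nd/ltW.
  have I2 : d y * (y - x) <= \int[lebesgue_measure]_(t in `]x, y]) d t.
    rewrite -[y - x]/(fine (y - x)%:E) -mxy -Rintegral_cst//.
    apply: le_Rintegral => // t /=; rewrite in_itv/= => /andP[xt ty].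
    exact/nd.
  have -> : w y - w x = (u y - u x) - \int[lebesgue_measure]_(t in `]x, y]) d t.
    by rewrite -hI /w !opprB [X in _ + X = _]addrC addrACA [X in _ + X = _]addrC.
  move: I1 I2 (sd x y ax xy yb).
  move: (\int[lebesgue_measure]_(t in `]x, y]) d t) (u y - u x) => I du I1 I2 /andP[h1 h2].
  rewrite ler_norml mulrBl; apply/andP; split.
    by rewrite opprB lerB.
  by rewrite lerB.
have := telescope_constant ab H; rewrite /w set_itv1 Rintegral_set1 subr0.
by move=> <-; rewrite subKr.
Qed.

Lemma resistance_supergradient (R : realType) (x0 : R) (u d : R -> R) :
  supergradient_on 0 x0 u d -> nonincreasing_fun d ->
  resistance x0 u =
  (\int[lebesgue_measure]_(x in `[0%R, x0]) ((1 + d x ^+ 2)^-1)%:E)%E.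
Proof.
move=> sd nd; rewrite /resistance.
pose N := [set x | x \in (`]0, x0[) /\ ~ is_derive x 1 u (d x)] `|` [set 0; x0].
have cN : countable N.
  rewrite /N -bigcup2E; apply: bigcup_countable => // -[|[|n]] _ /=.
  - exact: supergradient_countable.
  - exact/finite_set_countable/finite_set2.
  - exact/finite_set_countable.
(* Every subset of the countable set [N] is measurable, so [derive1 u] is measurable whatever values
   it takes on [N]; off [N] it equals [d]. *)
have mN B : B `<=` N -> measurable B.
  move=> BN; apply: countable_measurable; first by move=> t; exact: measurable_set1.
  exact: sub_countable (subset_card_le BN) cN.
have eqN x : (`[0, x0] `\` N) x -> derive1 u x = d x.
  move=> [/=]; rewrite in_itv/= => /andP[x_ge0 xx] nNx.
  rewrite derive1E; have [dx|ndx] := pselect (is_derive x 1 u (d x)).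
    exact: derive_val.
  exfalso; apply: nNx; have [->|x_neq0] := eqVneq x 0; first by right; left.
  have [->|x_neqx0] := eqVneq x x0; first by right; right.
  by left; split=> //; rewrite in_itv/= !lt_neqAle x_ge0 xx eq_sym x_neq0 x_neqx0.
have md : measurable_fun `[0, x0] (EFin \o (fun x => (1 + d x ^+ 2)^-1)).
  apply/measurable_EFinP.
  have mf := continuous_measurable_fun (@continuous_inv1sq R).
  apply: (measurableT_comp mf).
  exact: (nonincreasing_measurable _ nd).
apply: ge0_ae_eq_integral => //.
- rewrite -(setDUK (@subIsetl _ `[0, x0]%classic N)) setDIr setDv set0U.
  have mIN : measurable (`[0, x0] `&` N) by apply: mN; exact: subIsetr.
  apply/measurable_funU => //; first by apply: measurableD => //; exact: mN.
  split.
    by move=> _ B _; apply: mN => x [[_ Nx] _].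
  apply: (eq_measurable_fun (EFin \o (fun x => (1 + d x ^+ 2)^-1))).
    by move=> x /set_mem xN; rewrite /= eqN.
  by apply: measurable_funS md => // x [].
- by move=> x _; rewrite lee_fin invr_ge0 addr_ge0// sqr_ge0.
- by move=> x _; rewrite lee_fin invr_ge0 addr_ge0// sqr_ge0.
- exists N; split; [exact: mN|exact: countable_lebesgue_measure0|].
  move=> x /= /not_implyP[xI ne]; apply: contrapT => nNx; apply: ne.
  by rewrite eqN.
Qed.

(** The value [d x] itself may exceed [m], so the interval is cut at [x + r]: the bound [m] applies
    from there on, and the first piece contributes an excess that vanishes with [r]. *)
Lemma supergradient_ub (R : realType) (a b m : R) (u d : R -> R) (x y : R) :
  supergradient_on a b u d -> a <= x -> x < y -> y <= b ->
  (forall t, x < t < y -> d t <= m) -> u y - u x <= m * (y - x).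
Proof.
move=> sd ax xy yb dm; rewrite leNgt; apply/negP => lt_m.
pose e := u y - u x - m * (y - x); have e0 : 0 < e by rewrite /e; lra.
pose M := `|d x - m| + 1; have M0 : 0 < M by rewrite ltr_wpDl.
have dM : d x - m <= M by rewrite /M (le_trans (ler_norm _))// lerDl.
(* The first term keeps [x + r] strictly inside the interval, the second makes the excess over
   [[x, x + r]] at most half of the supposed gap [e]. *)
pose r := Num.min ((y - x) / 2) (e / (2 * M)).
have r0 : 0 < r by rewrite lt_min !divr_gt0 ?mulr_gt0// subr_gt0.
have r1 : r <= (y - x) / 2 by rewrite ge_min lexx.
have r2 : M * r <= e / 2.
  have : r <= e / (2 * M) by rewrite ge_min lexx orbT.
  move=> /(ler_wpM2l (ltW M0)) /le_trans; apply.
  by rewrite le_eqVlt; apply/orP; left; apply/eqP; field; rewrite gt_eqF.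
have dxr : (d x - m) * r <= M * r by rewrite ler_wpM2r// ltW.
have /andP[_ h1] := sd x (x + r) ax ltac:(lra) ltac:(lra).
have /andP[_ h2] := sd (x + r) y ltac:(lra) ltac:(lra) yb.
have h3 : d (x + r) * (y - (x + r)) <= m * (y - (x + r)).
  by rewrite ler_wpM2r ?dm//; lra.
rewrite /e in r2 e0; lra.
Qed.

(** Reflection preserves concavity and negates slopes, so lower bounds on increments follow from
    upper ones. *)
Lemma supergradient_reflect (R : realType) (a b : R) (u d : R -> R) :
  supergradient_on a b u d ->
  supergradient_on (- b) (- a) (fun x => u (- x)) (fun x => - d (- x)).
Proof.
move=> sd x y bx xy ya.
by have /andP[h1 h2] := sd (- y) (- x) ltac:(lra) ltac:(lra) ltac:(lra); lra.
Qed.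

Lemma supergradient_lb (R : realType) (a b m : R) (u d : R -> R) (x y : R) :
  supergradient_on a b u d -> a <= x -> x < y -> y <= b ->
  (forall t, x < t < y -> m <= d t) -> m * (y - x) <= u y - u x.
Proof.
move=> /supergradient_reflect sd ax xy yb dm.
have h t : - y < t < - x -> - d (- t) <= - m.
  by move=> txy; rewrite lerN2; apply: dm; lra.
have := supergradient_ub sd _ _ _ h.
by move=> /(_ ltac:(lra) ltac:(lra) ltac:(lra)); rewrite !opprK; lra.
Qed.

Lemma ae_exists_itv (R : realType) (a b : R) (P : R -> Prop) :
  a < b -> {ae lebesgue_measure, forall x, P x} -> exists2 x, a < x < b & P x.
Proof.
move=> ab [N [mN N0 PN]]; apply: contrapT => nP.
have sN : `]a, b[ `<=` N.
  move=> x /=; rewrite in_itv/= => xab; apply: PN => /= Px; apply: nP.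
  by exists x.
have : lebesgue_measure `]a, b[%classic = 0%E :> \bar R.
  exact: (subset_measure0 _ mN sN N0).
rewrite lebesgue_measure_itv/= lte_fin ab => /eqP.
by rewrite -EFinD eqe subr_eq0 gt_eqF.
Qed.

Lemma inv1sq_integrable (R : realType) (a b : R) (d : R -> R) :
  nonincreasing_fun d ->
  (@lebesgue_measure R).-integrable `[a, b] (EFin \o (fun x => (1 + d x ^+ 2)^-1)).
Proof.
move=> nd.
apply: (nonincreasing_comp_integrable (M := 1) nd (@continuous_inv1sq R)) => x _.
have h : 0 < 1 + d x ^+ 2 by rewrite ltr_pwDl// sqr_ge0.
by rewrite ger0_norm ?invr_ge0 ?(ltW h)// invf_le1// lerDl sqr_ge0.
Qed.

Lemma affine_integrable (R : realType) (a b al be : R) (d : R -> R) :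
  nonincreasing_fun d ->
  (@lebesgue_measure R).-integrable `[a, b] (EFin \o (fun x => al + be * d x)).
Proof.
move=> nd; have id_ := nonincreasing_integrable a b nd.
have ic := nonincreasing_integrable a b (d := fun=> al) (fun _ _ _ => lexx al).
rewrite (_ : EFin \o _ = (EFin \o (fun=> al)) \+ (fun x => be%:E * (EFin \o d) x))%E.
  by apply: integrableD => //; exact: integrableZl.
by apply/funext => x /=; rewrite EFinD EFinM.
Qed.

(** The affine part integrates to a quantity fixed by the boundary values, so comparing two
    admissible functions amounts to comparing their gap integrals. *)
Lemma resistance_gap (R : realType) (x0 al be : R) (u d : R -> R) :
  0 <= x0 -> supergradient_on 0 x0 u d -> nonincreasing_fun d ->
  resistance x0 u = (al * x0 + be * (u x0 - u 0) +
    \int[lebesgue_measure]_(x in `[0, x0])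
       ((1 + d x ^+ 2)^-1 - (al + be * d x)))%:E.
Proof.
move=> x0_ge0 sd nd; rewrite (resistance_supergradient sd nd).
have if_ := inv1sq_integrable 0 x0 nd.
have il := affine_integrable 0 x0 al be nd.
have id_ := nonincreasing_integrable 0 x0 nd.
have ic := nonincreasing_integrable 0 x0 (d := fun=> al) (fun _ _ _ => lexx al).
rewrite RintegralB// -[LHS]fineK; last exact: integrable_fin_num if_.
congr EFin; rewrite -[LHS](subrK (\int[lebesgue_measure]_(x in `[0, x0]) (al + be * d x))).
rewrite addrC; congr (_ + _).
rewrite RintegralD//; last first.
  by rewrite (_ : EFin \o _ = (fun x => be%:E * (EFin \o d) x))%E//; exact: integrableZl.
rewrite RintegralZl// (supergradient_integral x0_ge0 sd nd) Rintegral_cst//.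
congr (_ * _ + _).
have E : lebesgue_measure `[0, x0]%classic = x0%:E :> \bar R.
  rewrite lebesgue_measure_itv/= lte_fin lt_neqAle x0_ge0 andbT.
  case: eqVneq => [<-//|_] /=.
  by rewrite -EFinD subr0.
exact: (congr1 (@fine R) E).
Qed.

(** A nonnegative integrand with nonpositive integral vanishes almost everywhere; here this puts [d]
    in the contact set. *)
Lemma gap_ae_eq0 (R : realType) (x0 al be : R) (d : R -> R) :
  nonincreasing_fun d ->
  (forall x, al + be * d x <= (1 + d x ^+ 2)^-1) ->
  \int[lebesgue_measure]_(x in `[0, x0])
    ((1 + d x ^+ 2)^-1 - (al + be * d x)) <= 0 ->
  {ae lebesgue_measure, forall x, x \in `[0, x0] ->
    (1 + d x ^+ 2)^-1 = al + be * d x}.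
Proof.
move=> nd ge0 le0.
pose g x := (1 + d x ^+ 2)^-1 - (al + be * d x).
have g0 x : 0 <= g x by rewrite subr_ge0.
have ig : (@lebesgue_measure R).-integrable `[0, x0] (EFin \o g).
  rewrite (_ : EFin \o g = (EFin \o (fun x => (1 + d x ^+ 2)^-1)%R) \-
      (EFin \o (fun x => al + be * d x)%R))%E.
    by apply: integrableB => //; [exact: inv1sq_integrable|exact: affine_integrable].
  by apply/funext => x /=; rewrite EFinB.
have mg : measurable_fun `[0, x0] (EFin \o g) by exact: measurable_int ig.
have i0 : (\int[lebesgue_measure]_(x in `[0%R, x0]) `|(EFin \o g) x| = 0)%E.
  have -> : (\int[lebesgue_measure]_(x in `[0%R, x0]) `|(EFin \o g) x| =
      \int[lebesgue_measure]_(x in `[0%R, x0]) (EFin \o g) x)%E.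
    by apply: eq_integral => x _; rewrite /= ger0_norm.
  rewrite -[LHS]fineK; last exact: integrable_fin_num ig.
  congr EFin; apply/le_anti/andP; split; first exact: le0.
  by apply: Rintegral_ge0.
have := (ae_eq_integral_abs lebesgue_measure (measurable_itv _) mg).1 i0.
apply: filterS => x /= h xI.
by have [/eqP] := h xI; rewrite subr_eq0 => /eqP.
Qed.

(** * The two-slope function *)

(** When [p] or [q] is the slope [z0 / x0], this is a single segment on [[0, x0]]; one formula thus
    serves both the broken and the straight minimizers. *)
Definition roof (R : realType) (x0 z0 p q x : R) : R :=
  Num.min (p * x) (z0 + q * (x - x0)).

(** Abscissa at which the two lines of [roof] cross. *)
Definition ridge (R : realType) (x0 z0 p q : R) : R :=
  (z0 - q * x0) / (p - q).

Lemma roof_le_ridge (R : realType) (x0 z0 p q x : R) :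
  q < p -> x <= ridge x0 z0 p q -> roof x0 z0 p q x = p * x.
Proof.
by move=> qp; rewrite ler_pdivlMr ?subr_gt0// => h; apply/min_idPl; lra.
Qed.

Lemma roof_ge_ridge (R : realType) (x0 z0 p q x : R) :
  q < p -> ridge x0 z0 p q <= x -> roof x0 z0 p q x = z0 + q * (x - x0).
Proof.
by move=> qp; rewrite ler_pdivrMr ?subr_gt0// => h; apply/min_idPr; lra.
Qed.

Lemma ridgeE (R : realType) (x0 z0 p q : R) : q < p ->
  p * ridge x0 z0 p q = z0 + q * (ridge x0 z0 p q - x0).
Proof. by move=> qp; rewrite /ridge; field; rewrite subr_eq0 gt_eqF. Qed.

Lemma ridge_ge0 (R : realType) (x0 z0 p q : R) :
  q < p -> (0 <= ridge x0 z0 p q) = (q * x0 <= z0).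
Proof. by move=> qp; rewrite ler_pdivlMr ?subr_gt0// mul0r subr_ge0. Qed.

Lemma ridge_gt0 (R : realType) (x0 z0 p q : R) :
  q < p -> (0 < ridge x0 z0 p q) = (q * x0 < z0).
Proof. by move=> qp; rewrite ltr_pdivlMr ?subr_gt0// mul0r subr_gt0. Qed.

Lemma ridge_le (R : realType) (x0 z0 p q : R) :
  q < p -> (ridge x0 z0 p q <= x0) = (z0 <= p * x0).
Proof.
by move=> qp; rewrite ler_pdivrMr ?subr_gt0// mulrBr lerBlDr (mulrC x0 q) subrK mulrC.
Qed.

Lemma ridge_lt (R : realType) (x0 z0 p q : R) :
  q < p -> (ridge x0 z0 p q < x0) = (z0 < p * x0).
Proof.
by move=> qp; rewrite ltr_pdivrMr ?subr_gt0// mulrBr ltrBlDr (mulrC x0 q) subrK mulrC.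
Qed.

Lemma roof_continuous (R : realType) (x0 z0 p q : R) :
  continuous (roof x0 z0 p q).
Proof.
move=> x; apply: continuous_min; first by apply: cvgMr; exact: cvg_id.
apply: cvgD; first exact: cvg_cst.
by apply: cvgMr; apply: cvgB; [exact: cvg_id|exact: cvg_cst].
Qed.

Lemma roof_concave (R : realType) (x0 z0 p q a b : R) :
  concave_on a b (roof x0 z0 p q).
Proof.
move=> t x y _ _.
have t0 : 0 <= t%:num by [].
have t1 : t%:num <= 1 by [].
rewrite convRE/= /unstable.onem.
have -> : conv t (x : convex_lmodType R^o) y = t%:num * x + (1 - t%:num) * y by [].
have hx : roof x0 z0 p q x <= p * x /\ roof x0 z0 p q x <= z0 + q * (x - x0).
  by split; rewrite /roof ge_min lexx ?orbT.
have hy : roof x0 z0 p q y <= p * y /\ roof x0 z0 p q y <= z0 + q * (y - x0).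
  by split; rewrite /roof ge_min lexx ?orbT.
move: (roof x0 z0 p q x) (roof x0 z0 p q y) hx hy => X Y [X1 X2] [Y1 Y2].
move: t%:num t0 t1 => s s0 s1.
have s1' : 0 <= 1 - s by lra.
rewrite lerNl opprD !mulrN !opprK /roof le_min; apply/andP; split.
  by have := ler_wpM2l s0 X1; have := ler_wpM2l s1' Y1; lra.
by have := ler_wpM2l s0 X2; have := ler_wpM2l s1' Y2; lra.
Qed.

(** A two-sided derivative is also the limit of the difference quotients from the right, so bounds
    on slopes to the right suffice. *)
Lemma derive1_slope_bounds (R : realType) (b m M x : R) (u : R -> R) :
  x < b -> derivable u x 1 ->
  (forall y, x < y -> y < b -> m * (y - x) <= u y - u x <= M * (y - x)) ->
  m <= derive1 u x <= M.
Proof.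
move=> xb du H; rewrite derive1E.
have c : h^-1 *: ((u \o shift x) (h *: (1 : R)) - u x) @[h --> 0^'+] --> 'D_1 u x.
  exact: cvg_dnbhs_at_right du.
have near_b : \forall h \near (0 : R)^'+, m <= h^-1 *: ((u \o shift x) (h *: (1 : R)) - u x) <= M.
  near=> h.
  have h0 : 0 < h by near: h; exact: nbhs_right_gt.
  have hb : h < b - x by near: h; apply: nbhs_right_lt; rewrite subr_gt0.
  have /andP[] := H (h + x) ltac:(lra) ltac:(lra).
  rewrite addrK /= [h *: 1]mulr1 /shift/= [_ *: _]mulrC => h1 h2.
  by rewrite ler_pdivlMr// ler_pdivrMr// h1.
apply/andP; split.
  by apply: (cvgr_to_ge c); apply: filterS near_b => h /andP[].
by apply: (cvgr_to_le c); apply: filterS near_b => h /andP[].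
Unshelve. all: by end_near. Qed.

(** * Optimality and uniqueness of the two-slope function *)

Section roof_optimality.
Variables (R : realType) (x0 z0 K0 p q : R).
Hypotheses (x0_gt0 : 0 < x0) (K0E : K0 = z0 / x0) (qp : q < p).
Hypotheses (qK : q <= K0) (Kp : K0 <= p).

Let u := roof x0 z0 p q.
Let c := ridge x0 z0 p q.

Let z0E : z0 = K0 * x0. Proof. by rewrite K0E divfK ?gt_eqF. Qed.

Let u0 : u 0 = 0.
Proof. by rewrite /u roof_le_ridge ?mulr0// ridge_ge0// z0E ler_pM2r. Qed.

Let ux0 : u x0 = z0.
Proof.
by rewrite /u roof_ge_ridge ?subrr ?mulr0 ?addr0// ridge_le// z0E ler_pM2r.
Qed.

(* The test K0 == p covers the ridge at x0, where x < c alone would give the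
   slope q at the endpoint, outside the contact set. *)
Let slope x := if (K0 == p) || (x < c) then p else q.

Let slope_nonincreasing : nonincreasing_fun slope.
Proof.
move=> x y xy; rewrite /slope; case: (K0 == p) => //=.
case: (ltP y c) => yc; first by rewrite (le_lt_trans xy yc).
by case: ifP => // _; exact: ltW.
Qed.

Lemma roof_slopes x y : x < y ->
  q * (y - x) <= roof x0 z0 p q y - roof x0 z0 p q x <= p * (y - x).
Proof.
move=> xy.
have h : q * (y - x) <= p * (y - x) by rewrite ler_wpM2r ?ltW ?subr_gt0.
(* Lying below both lines is what settles the case where [x] and [y] are on different sides of the
   ridge. *)
have hx : u x <= p * x /\ u x <= z0 + q * (x - x0).
  by split; rewrite /u /roof ge_min lexx ?orbT.
have hy : u y <= p * y /\ u y <= z0 + q * (y - x0).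
  by split; rewrite /u /roof ge_min lexx ?orbT.
rewrite -/u; have [xc|/ltW cx] := leP x c.
  have := roof_le_ridge qp xc; rewrite -/u => ex.
  have [yc|/ltW cy] := leP y c.
    have := roof_le_ridge qp yc; rewrite -/u => ->; apply/andP; split; lra.
  have := roof_ge_ridge qp cy; rewrite -/u => ey; apply/andP; split; lra.
have := roof_ge_ridge qp cx; rewrite -/u => ->.
have := roof_ge_ridge qp (le_trans cx (ltW xy)); rewrite -/u => ->.
by apply/andP; split; lra.
Qed.

Let slope_supergradient : supergradient_on 0 x0 u slope.
Proof.
move=> x y x_ge0 xy yx; have /andP[h1 h2] := roof_slopes xy.
rewrite /slope; case: eqVneq => [K0p|_] /=.
  have hc : x0 <= c by rewrite ler_pdivlMr ?subr_gt0// z0E K0p; lra.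
  rewrite /u (roof_le_ridge qp (le_trans yx hc)).
  rewrite (roof_le_ridge qp (le_trans (ltW xy) (le_trans yx hc))).
  by rewrite -mulrBr lexx.
case: ltP => yc; case: ltP => xc; rewrite ?h1 ?h2//.
- rewrite /u (roof_le_ridge qp (ltW yc)) (roof_le_ridge qp (ltW xc)).
  by rewrite -mulrBr lexx.
- by have := lt_trans xy yc; rewrite ltNge xc.
- rewrite /u (roof_ge_ridge qp yc) (roof_ge_ridge qp xc).
  by apply/andP; split; lra.
Qed.

Lemma roof_adm k1 k2 : k2 <= q -> p <= k1 -> adm_class x0 z0 k1 k2 (roof x0 z0 p q).
Proof.
move=> kq pk; split => //.
- by apply: continuous_subspaceT; exact: roof_continuous.
- exact: roof_concave.
- move=> x /andP[x_gt0 xx] du.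
  have /andP[h1 h2] := derive1_slope_bounds xx du (fun y xy _ => roof_slopes xy).
  by apply/andP; split; lra.
Qed.

Lemma roof_two_slopes : q < K0 -> K0 < p -> two_slopes x0 (roof x0 z0 p q) p q.
Proof.
move=> qK' Kp'; split=> //; exists c; split.
- by rewrite ridge_gt0// ridge_lt// z0E !ltr_pM2r// qK'.
- exists 0, p => x; rewrite in_itv/= => /andP[_ xc].
  by rewrite add0r; exact: roof_le_ridge.
- exists (z0 - q * x0), q => x; rewrite in_itv/= => /andP[cx _].
  by rewrite roof_ge_ridge//; ring.
- move=> x /andP[_ xc]; apply: is_derive_slopeP => e e0.
  exists (c - x); first by rewrite subr_gt0.
  move=> y yx yr; have yc : y <= c.
    by have := le_lt_trans (ler_norm _) yr; lra.
  rewrite (roof_le_ridge qp yc) (roof_le_ridge qp (ltW xc)).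
  by rewrite -mulrBr mulfK ?subr_eq0// subrr normr0 ltW.
- move=> x /andP[cx _]; apply: is_derive_slopeP => e e0.
  exists (x - c); first by rewrite subr_gt0.
  move=> y yx yr; have cy : c <= y.
    by rewrite distrC in yr; have := le_lt_trans (ler_norm _) yr; lra.
  rewrite (roof_ge_ridge qp cy) (roof_ge_ridge qp (ltW cx)).
  have -> : z0 + q * (y - x0) - (z0 + q * (x - x0)) = q * (y - x) by ring.
  by rewrite mulfK ?subr_eq0// subrr normr0 ltW.
Qed.

Variables (k1 k2 al be : R).
Hypotheses (kq : k2 <= q) (pk : p <= k1).
Hypothesis minorant : forall t, k2 <= t <= k1 -> al + be * t <= (1 + t ^+ 2)^-1.
Hypothesis contact : forall t, k2 <= t <= k1 -> (1 + t ^+ 2)^-1 = al + be * t ->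
  t = p \/ t = q.
(** Contact is required of a slope when it occurs on an interval of positive length: [p] occurs when
    the ridge lies to the right of 0, that is [q < K0], and [q] when the ridge lies to the left of
    [x0], that is [K0 < p]. *)
Hypothesis contact_p : q < K0 -> (1 + p ^+ 2)^-1 = al + be * p.
Hypothesis contact_q : K0 < p -> (1 + q ^+ 2)^-1 = al + be * q.

(** On [[0, x0]] the function [slope] takes only contact values, so the gap vanishes and the affine
    part remains. *)
Let resistance_roof : resistance x0 u = (al * x0 + be * z0)%:E.
Proof.
rewrite (resistance_gap al be (ltW x0_gt0) slope_supergradient slope_nonincreasing).
rewrite u0 ux0 subr0 (_ : \int[_]_(_ in _) _ = 0) ?addr0//.
transitivity (\int[lebesgue_measure]_(x in `[0, x0]) (0 : R)).
  2: by rewrite Rintegral_cst// mul0r.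
apply: eq_Rintegral => x; rewrite inE/= in_itv/= => /andP[x_ge0 xx].
apply/eqP; rewrite subr_eq0; apply/eqP; rewrite /slope.
have qKc : 0 < c -> q < K0 by rewrite ridge_gt0// z0E ltr_pM2r.
case: eqVneq => [K0p|K0p] /=; first by apply: contact_p; rewrite K0p.
case: ltP => xc; first by apply/contact_p/qKc; exact: le_lt_trans xc.
by apply: contact_q; rewrite lt_neqAle K0p.
Qed.

Theorem roof_is_solution : is_solution x0 z0 k1 k2 (roof x0 z0 p q).
Proof.
split; first exact: roof_adm.
move=> v av; have k21 : k2 <= k1 := le_trans kq (le_trans (ltW qp) pk).
have [d [sd nd dk]] := adm_class_supergradient x0_gt0 k21 av.
have [_ _ v0 vx0 _] := av.
rewrite -/u resistance_roof (resistance_gap al be (ltW x0_gt0) sd nd).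
rewrite v0 vx0 subr0 lee_fin lerDl; apply: Rintegral_ge0 => x _.
by rewrite subr_ge0; exact: minorant.
Qed.

Theorem roof_unique v : is_solution x0 z0 k1 k2 v ->
  forall x, x \in `[0, x0] -> v x = roof x0 z0 p q x.
Proof.
move=> [av minv]; have k21 : k2 <= k1 := le_trans kq (le_trans (ltW qp) pk).
have [d [sd nd dk]] := adm_class_supergradient x0_gt0 k21 av.
have [_ _ v0 vx0 _] := av.
have := minv _ (roof_adm kq pk).
rewrite -/u resistance_roof (resistance_gap al be (ltW x0_gt0) sd nd).
rewrite v0 vx0 subr0 lee_fin gerDl.
move=> /(gap_ae_eq0 nd (fun x => minorant (dk x))) pq_ae.
(* Equality almost everywhere yields contact points in every subinterval; monotonicity of [d] then
   extends the bounds [p] and [q] to all interior points. *)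
have pq a b : 0 <= a -> a < b -> b <= x0 -> exists2 t, a < t < b & d t = p \/ d t = q.
  move=> a0 ab bx; have [t tab ht] := ae_exists_itv ab pq_ae.
  by exists t => //; apply: contact => //; apply: ht; rewrite in_itv/=; lra.
have d_le_p t : 0 < t -> t < x0 -> d t <= p.
  move=> t0 tx; have [s /andP[_ st] hs] := pq 0 t (lexx 0) t0 (ltW tx).
  by apply: le_trans (nd _ _ (ltW st)) _; case: hs => ->//; exact: ltW.
have q_le_d t : 0 < t -> t < x0 -> q <= d t.
  move=> t0 tx; have [s /andP[ts _] hs] := pq t x0 (ltW t0) tx (lexx x0).
  by apply: le_trans (nd _ _ (ltW ts)); case: hs => ->//; exact: ltW.
move=> x; rewrite in_itv/= => /andP[x_ge0 xx].
have [->|x_neq0] := eqVneq x 0; first by rewrite v0; exact: esym u0.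
have [->|x_neqx0] := eqVneq x x0; first by rewrite vx0; exact: esym ux0.
have x_gt0 : 0 < x by rewrite lt_neqAle eq_sym x_neq0.
have x_ltx0 : x < x0 by rewrite lt_neqAle x_neqx0.
apply/le_anti/andP; split.
  rewrite /roof le_min; apply/andP; split.
    have : v x - v 0 <= p * (x - 0).
      by apply: (supergradient_ub sd) => // t /andP[? ?]; apply: d_le_p; lra.
    by rewrite v0 !subr0.
  have : q * (x0 - x) <= v x0 - v x.
    by apply: (supergradient_lb sd) => // t /andP[? ?]; apply: q_le_d; lra.
  by rewrite vx0; lra.
(* Dichotomy on [d x]. If it is below [p], contact values to the right of [x] can only be [q], so
   [v] is at least the line through the right endpoint; otherwise [d] is at least [p] to the left of
   [x], so [v] is at least the line through the origin. *)
rewrite /roof ge_min; have [dp|pd] := ltP (d x) p; apply/orP.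
  right; have : v x0 - v x <= q * (x0 - x).
    apply: (supergradient_ub sd) => // t /andP[xt tx].
    have [s /andP[xs st] hs] := pq x t x_ge0 xt (ltW tx).
    apply: le_trans (nd _ _ (ltW st)) _; case: hs => [ds|->//].
    by have := nd _ _ (ltW xs); rewrite ds leNgt dp.
  by rewrite vx0; lra.
left; have : p * (x - 0) <= v x - v 0.
  apply: (supergradient_lb sd) => // t /andP[_ tx].
  by apply: le_trans (nd _ _ (ltW tx)).
by rewrite v0 !subr0.
Qed.

End roof_optimality.

(** * Graphs and chords *)

Lemma segment_affine (R : realType) (a b m : R) (f : R -> R) :
  a < b -> (forall x, a <= x <= b -> f x = f a + m * (x - a)) ->
  segment (a, f a) (b, f b) = [set (x, f x) | x in `[a, b]].
Proof.
move=> ab fE; have fb := fE b ltac:(lra).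
apply/seteqP; split=> [_ [t /= + <-]|_ [x /= + <-]]; rewrite in_itv/= => /andP[h0 h1].
  have t0 : 0 <= t * (b - a) by rewrite mulr_ge0// subr_ge0 ltW.
  have t1 : t * (b - a) <= b - a by rewrite ler_piMl// subr_ge0 ltW.
  exists ((1 - t) * a + t * b); first by rewrite /= in_itv/=; apply/andP; split; lra.
  by congr (_, _); rewrite fb fE; [ring|apply/andP; split; lra].
have ba : 0 < b - a by rewrite subr_gt0.
exists ((x - a) / (b - a)).
  by rewrite /= in_itv/= divr_ge0 ?subr_ge0 ?(ltW ab)//= ler_pdivrMr// mul1r lerD2r.
rewrite /= fb (fE x) ?h0//.
by congr (_, _) => /=; field; rewrite gt_eqF.
Qed.

Lemma roof_graph (R : realType) (x0 z0 p q : R) :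
  q < p -> q * x0 < z0 -> z0 < p * x0 ->
  graph_on x0 (roof x0 z0 p q) =
  broken_line (0, 0) (ridge x0 z0 p q, p * ridge x0 z0 p q) (x0, z0).
Proof.
move=> qp qz zp; set c := ridge x0 z0 p q.
have c0 : 0 < c by rewrite ridge_gt0.
have cx : c < x0 by rewrite ridge_lt.
have u0 : roof x0 z0 p q 0 = 0 by rewrite roof_le_ridge ?mulr0// ltW.
have uc : roof x0 z0 p q c = p * c by rewrite roof_le_ridge.
have ux0 : roof x0 z0 p q x0 = z0.
  by rewrite roof_ge_ridge ?subrr ?mulr0 ?addr0// ltW.
have S1 := @segment_affine R 0 c p (roof x0 z0 p q) c0.
rewrite u0 uc in S1; have S2 := @segment_affine R c x0 q (roof x0 z0 p q) cx.
rewrite uc ux0 in S2.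
rewrite /broken_line S1; last first.
  by move=> x /andP[_ xc]; rewrite roof_le_ridge// add0r subr0.
rewrite S2; last first.
  move=> x /andP[cx' _]; rewrite roof_ge_ridge// [p * c]ridgeE// -/c; ring.
apply/seteqP; split=> [_ [x /= + <-]|_ [|] [x /= + <-]]; rewrite in_itv/= => /andP[h0 h1].
- have [xc|/ltW cx'] := leP x c.
    by left; exists x => //=; rewrite in_itv/= h0.
  by right; exists x => //=; rewrite in_itv/= cx'.
- by exists x => //=; rewrite in_itv/= h0 (le_trans h1 (ltW cx)).
- by exists x => //=; rewrite in_itv/= h1 (le_trans (ltW c0) h0).
Qed.

Lemma linear_graph (R : realType) (x0 K : R) (u : R -> R) :
  0 < x0 -> (forall x, x \in `[0, x0] -> u x = K * x) ->
  graph_on x0 u = segment (0, 0) (x0, K * x0).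
Proof.
move=> x0_gt0 uE.
have u0 : u 0 = 0 by rewrite uE ?mulr0// in_itv/= lexx ltW.
have ux0 : u x0 = K * x0 by rewrite uE// in_itv/= lexx ltW.
have := @segment_affine R 0 x0 K u x0_gt0; rewrite u0 ux0 => ->//.
by move=> x xI; rewrite uE ?in_itv// add0r subr0.
Qed.

(** Difference quotient of 1/(1 + t^2) between [p] and [q] with the factor [p - q] cancelled, so
    that it still makes sense for [p = q]. *)
Definition chord_slope (R : realType) (p q : R) : R :=
  - (p + q) / ((1 + p ^+ 2) * (1 + q ^+ 2)).

Definition chord_intercept (R : realType) (p q : R) : R :=
  (1 + p ^+ 2)^-1 - chord_slope p q * p.

(* For p = q the chord is the tangent at p. *)
Lemma chord_gap (R : realType) (p q t : R) :
  (1 + t ^+ 2)^-1 - (chord_intercept p q + chord_slope p q * t) =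
  (t - p) * (t - q) * ((p + q) * t + p * q - 1) /
  ((1 + p ^+ 2) * (1 + q ^+ 2) * (1 + t ^+ 2)).
Proof.
have sq (x : R) : 1 + x ^+ 2 != 0 by rewrite gt_eqF// ltr_pwDl// sqr_ge0.
rewrite /chord_intercept /chord_slope; field.
by rewrite !sq.
Qed.

Lemma chord_minorant (R : realType) (p q t : R) :
  0 <= (t - p) * (t - q) * ((p + q) * t + p * q - 1) ->
  chord_intercept p q + chord_slope p q * t <= (1 + t ^+ 2)^-1.
Proof.
have sq (x : R) : 0 < 1 + x ^+ 2 by rewrite ltr_pwDl// sqr_ge0.
by move=> h; rewrite -subr_ge0 chord_gap divr_ge0// !mulr_ge0// ltW.
Qed.

(** The linear factor describes the third intersection of the line with the curve; it stays an
    equation because [p + q] may be 0. *)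
Lemma chord_contact (R : realType) (p q t : R) :
  ((1 + t ^+ 2)^-1 = chord_intercept p q + chord_slope p q * t) <->
  [\/ t = p, t = q | (p + q) * t + p * q - 1 = 0].
Proof.
have sq (x : R) : 1 + x ^+ 2 != 0 by rewrite gt_eqF// ltr_pwDl// sqr_ge0.
split=> [/eqP|h].
  rewrite -subr_eq0 chord_gap mulf_eq0 invr_eq0 !mulf_eq0 !(negbTE (sq _)) !orbF.
  by rewrite !subr_eq0 => /orP[/orP[]|] /eqP h; [apply: Or31|apply: Or32|apply: Or33; rewrite h subrr].
apply/eqP; rewrite -subr_eq0 chord_gap.
by case: h => [->|->|->]; rewrite ?subrr ?mulr0 ?mul0r.
Qed.

(** * Minimizers *)

Definition is_unique_solution (R : realType) (x0 z0 k1 k2 : R) (u : R -> R) : Prop :=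
  is_solution x0 z0 k1 k2 u /\
  forall v, is_solution x0 z0 k1 k2 v -> forall x, x \in `[0, x0] -> v x = u x.

Section minimizers.
Variables (R : realType) (x0 z0 K0 k1 k2 : R).
Hypotheses (x0_gt0 : 0 < x0) (K0E : K0 = z0 / x0) (kK : k2 < K0) (Kk : K0 < k1).

(* [P], [Q] are the slopes of the solution; the affine minorant of 1/(1+t^2) is
   its chord through the abscissae [p], [q]. *)
Lemma roof_solves P Q p q : Q < P -> k2 <= Q <= K0 -> K0 <= P <= k1 ->
  (forall t, k2 <= t <= k1 -> 0 <= (t - p) * (t - q) * ((p + q) * t + p * q - 1)) ->
  (forall t, k2 <= t <= k1 ->
     [\/ t = p, t = q | (p + q) * t + p * q - 1 = 0] -> t = P \/ t = Q) ->
  (Q < K0 -> P = p \/ P = q) -> (K0 < P -> Q = p \/ Q = q) ->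
  is_unique_solution x0 z0 k1 k2 (roof x0 z0 P Q).
Proof.
move=> QP /andP[kQ QK] /andP[KP Pk] ge0 ct cP cQ.
have mi t : k2 <= t <= k1 ->
    chord_intercept p q + chord_slope p q * t <= (1 + t ^+ 2)^-1.
  by move=> /ge0; exact: chord_minorant.
have cc t (tk : k2 <= t <= k1) : (1 + t ^+ 2)^-1 = chord_intercept p q + chord_slope p q * t ->
    t = P \/ t = Q by move/chord_contact; exact: ct.
have tc t : t = p \/ t = q -> (1 + t ^+ 2)^-1 = chord_intercept p q + chord_slope p q * t.
  by move=> h; apply/chord_contact; case: h => h; [exact: Or31|exact: Or32].
split.
  exact: (roof_is_solution x0_gt0 K0E QP QK KP kQ Pk mi
    (fun h => tc _ (cP h)) (fun h => tc _ (cQ h))).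
exact: (roof_unique x0_gt0 K0E QP QK KP kQ Pk mi cc
    (fun h => tc _ (cP h)) (fun h => tc _ (cQ h))).
Qed.

Lemma broken_solves P Q : Q < K0 -> K0 < P -> k2 <= Q -> P <= k1 ->
  (forall t, k2 <= t <= k1 -> 0 <= (t - P) * (t - Q) * ((P + Q) * t + P * Q - 1)) ->
  (forall t, k2 <= t <= k1 -> (P + Q) * t + P * Q - 1 = 0 -> t = P \/ t = Q) ->
  is_unique_solution x0 z0 k1 k2 (roof x0 z0 P Q).
Proof.
move=> QK KP kQ Pk ge0 ct; apply: (roof_solves (p := P) (q := Q)) => //.
- exact: lt_trans KP.
- by rewrite kQ ltW.
- by rewrite Pk ltW.
- by move=> t tk [->|->|]; [left|right|exact: ct].
- by left.
- by right.
Qed.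

(** The factor is affine in [t], and the two quadratic hypotheses say that it is nonpositive at [P]
    and at [Q]; in between it is a convex combination of these values. *)
Lemma chord_nonpos (P Q t : R) : Q < P -> P ^+ 2 + 2 * P * Q <= 1 -> Q ^+ 2 + 2 * P * Q <= 1 ->
  Q <= t <= P ->
  (P + Q) * t + P * Q - 1 <= 0 /\
  ((P + Q) * t + P * Q - 1 = 0 -> t = P \/ t = Q).
Proof.
move=> QP hP hQ /andP[Qt tP].
pose l t := (P + Q) * t + P * Q - 1.
have lP : l P <= 0 by rewrite /l; nra.
have lQ : l Q <= 0 by rewrite /l; nra.
have e : (P - Q) * l t = (t - Q) * l P + (P - t) * l Q by rewrite /l; ring.
have PQ : 0 < P - Q by rewrite subr_gt0.
have a1 : (t - Q) * l P <= 0 by rewrite mulr_ge0_le0// subr_ge0.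
have a2 : (P - t) * l Q <= 0 by rewrite mulr_ge0_le0// subr_ge0.
split; first by rewrite -(pmulr_rle0 _ PQ) -/(l t) e; lra.
rewrite -/(l t) => lt0; rewrite lt0 mulr0 in e.
have b1 : (t - Q) * l P = 0 by lra.
have b2 : (P - t) * l Q = 0 by lra.
(* A zero away from [P] and [Q] forces [l] to vanish at both ends, hence [P + Q = 0]; but then [l]
   is the negative constant [- P ^+ 2 - 1]. *)
move/eqP: b1; rewrite mulf_eq0 subr_eq0 => /orP[/eqP|/eqP lP0]; first by right.
move/eqP: b2; rewrite mulf_eq0 subr_eq0 => /orP[/eqP|/eqP lQ0]; first by left.
exfalso; have := sqr_ge0 P.
have : (P - Q) * (P + Q) = 0 by move: lP0 lQ0; rewrite /l => ? ?; lra.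
move/eqP; rewrite mulf_eq0 gt_eqF//= => /eqP PQ0.
by move: lP0; rewrite /l PQ0 (_ : Q = - P); [nra|lra].
Qed.

(** The minorant is the tangent at [K0]. It stays below the curve down to [k2] because
    [K0 + k2 >= s] squares to [K0 ^+ 2 + 2 * K0 * k2 >= 1]. In the borderline case it also touches
    at [k2], which is why [k2] is taken as second slope of a [roof] that is straight on
    [[0, x0]]. *)
Lemma straight_right_solves (s : R) : 0 < s -> s ^+ 2 = 1 + k2 ^+ 2 -> s - k2 <= K0 ->
  is_unique_solution x0 z0 k1 k2 (roof x0 z0 K0 k2).
Proof.
move=> s0 s2 sK.
have K_gt0 : 0 < K0 by nra.
have h t : k2 <= t -> 0 <= (K0 + K0) * t + K0 * K0 - 1 /\
    ((K0 + K0) * t + K0 * K0 - 1 = 0 -> t = k2).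
  move=> kt.
  have h1 : 0 <= (K0 + K0) * k2 + K0 * K0 - 1 by nra.
  have h2 : 0 <= K0 * (t - k2) by rewrite mulr_ge0 ?(ltW K_gt0)// subr_ge0.
  split; first by lra.
  move=> h3; have : K0 * (t - k2) = 0 by lra.
  by move/eqP; rewrite mulf_eq0 gt_eqF//= subr_eq0 => /eqP.
apply: (roof_solves (p := K0) (q := K0)) => //.
- by rewrite lexx ltW.
- by rewrite lexx ltW.
- by move=> t /andP[/h[h1 _] _]; rewrite mulr_ge0// -expr2 sqr_ge0.
- by move=> t /andP[/h[_ h1] _] [->|->|/h1]; [left|left|right].
- by left.
- by rewrite ltxx.
Qed.

(** Mirror image of the previous case: the tangent at [K0] can touch the curve a second time only at
    [k1], and the ridge sits at 0. *)
Lemma straight_left_solves (s : R) : 0 < s -> s ^+ 2 = 1 + k1 ^+ 2 -> K0 <= - s - k1 ->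
  is_unique_solution x0 z0 k1 k2 (roof x0 z0 k1 K0).
Proof.
move=> s0 s2 sK.
have K_lt0 : K0 < 0 by nra.
have h t : t <= k1 -> 0 <= (K0 + K0) * t + K0 * K0 - 1 /\
    ((K0 + K0) * t + K0 * K0 - 1 = 0 -> t = k1).
  move=> kt.
  have h1 : 0 <= (K0 + K0) * k1 + K0 * K0 - 1 by nra.
  have h2 : 0 <= K0 * (t - k1) by rewrite mulr_le0 ?(ltW K_lt0)// subr_le0.
  split; first by lra.
  move=> h3; have : K0 * (t - k1) = 0 by lra.
  by move/eqP; rewrite mulf_eq0 lt_eqF//= subr_eq0 => /eqP.
apply: (roof_solves (p := K0) (q := K0)) => //.
- by rewrite lexx ltW.
- by rewrite lexx ltW.
- by move=> t /andP[_ /h[h1 _]]; rewrite mulr_ge0// -expr2 sqr_ge0.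
- by move=> t /andP[_ /h[_ h1]] [->|->|/h1]; [right|right|left].
- by rewrite ltxx.
- by left.
Qed.

(** The minorant is the chord through [k1] and [k2]. The sign of [k1 + k2] decides which of the two
    hypotheses of [chord_nonpos] is stronger, and that one is the squared bound by [s2] or by
    [s1]. *)
Lemma full_solves (s1 s2 : R) : 0 < s1 -> 0 < s2 ->
  s1 ^+ 2 = 1 + k1 ^+ 2 -> s2 ^+ 2 = 1 + k2 ^+ 2 -> - s1 <= k1 + k2 <= s2 ->
  is_unique_solution x0 z0 k1 k2 (roof x0 z0 k1 k2).
Proof.
move=> s1_gt0 s2_gt0 es1 es2 /andP[h1 h2].
have k21 : k2 < k1 := lt_trans kK Kk.
have [hP hQ] : k1 ^+ 2 + 2 * k1 * k2 <= 1 /\ k2 ^+ 2 + 2 * k1 * k2 <= 1.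
  have [k0|k0] := leP 0 (k1 + k2).
    have : (k1 + k2) ^+ 2 <= s2 ^+ 2 by rewrite ler_sqr ?nnegrE// ltW.
    have : 0 <= (k1 - k2) * (k1 + k2) by rewrite mulr_ge0// subr_ge0 ltW.
    by rewrite es2 => ? ?; split; lra.
  have : (- (k1 + k2)) ^+ 2 <= s1 ^+ 2.
    by rewrite ler_sqr ?nnegrE; lra.
  have : 0 <= (k1 - k2) * - (k1 + k2) by apply: mulr_ge0; lra.
  by rewrite es1 => ? ?; split; lra.
apply: broken_solves => // t tk; have [l0 lc] := chord_nonpos k21 hP hQ tk => //.
by move: tk => /andP[kt tk]; apply: mulr_le0 => //; apply: mulr_le0_ge0; lra.
Qed.

(** The line through the curve at [k2] is tangent at [s - k2]: the third intersection coincides with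
    that abscissa, so the numerator of the gap is a square times [s * (t - k2)]. *)
Lemma tangent_right_solves (s : R) : 0 < s -> s ^+ 2 = 1 + k2 ^+ 2 ->
  K0 < s - k2 -> s - k2 <= k1 -> is_unique_solution x0 z0 k1 k2 (roof x0 z0 (s - k2) k2).
Proof.
move=> s0 es Ks sk.
have e t : (s - k2 + k2) * t + (s - k2) * k2 - 1 = s * (t - (s - k2)).
  by rewrite subrK; lra.
apply: broken_solves => // t /andP[kt tk]; rewrite e.
  have -> : (t - (s - k2)) * (t - k2) * (s * (t - (s - k2))) =
    (s * (t - k2)) * (t - (s - k2)) ^+ 2 by ring.
  by rewrite mulr_ge0 ?sqr_ge0// mulr_ge0 ?(ltW s0)// subr_ge0.
by move/eqP; rewrite mulf_eq0 gt_eqF//= subr_eq0 => /eqP; left.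
Qed.

(** Mirror image: the line through the curve at [k1] is tangent at [- s - k1]. *)
Lemma tangent_left_solves (s : R) : 0 < s -> s ^+ 2 = 1 + k1 ^+ 2 ->
  - s - k1 < K0 -> k2 <= - s - k1 -> is_unique_solution x0 z0 k1 k2 (roof x0 z0 k1 (- s - k1)).
Proof.
move=> s0 es Ks sk.
have e t : (k1 + (- s - k1)) * t + k1 * (- s - k1) - 1 = - s * (t - (- s - k1)).
  by lra.
apply: broken_solves => // t /andP[kt tk]; rewrite e.
  have -> : (t - k1) * (t - (- s - k1)) * (- s * (t - (- s - k1))) =
    (s * (k1 - t)) * (t - (- s - k1)) ^+ 2 by ring.
  by rewrite mulr_ge0 ?sqr_ge0// mulr_ge0 ?(ltW s0)// subr_ge0.
by move/eqP; rewrite mulf_eq0 oppr_eq0 gt_eqF//= subr_eq0 => /eqP; right.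
Qed.

End minimizers.

(** * Case distinction by the positions of [K0] and of [k1 + k2] *)

Theorem lemma1 (R : realType) (x0 z0 k1 k2 K0 : R) (A B C : R * R)
    (hx0 : 0 < x0) (hB1 : x0 ^+ 2 + z0 ^+ 2 = 1)
    (hK0 : K0 = z0 / x0) (hK2 : k2 < K0) (hK1 : K0 < k1)
    (hA : A = (0, 0)) (hB : B = (x0, z0))
    (hAC : C.2 = k1 * C.1) (hBC : C.2 = z0 + k2 * (C.1 - x0)) :
  exists u : R -> R,
    is_solution x0 z0 k1 k2 u /\
    (forall v : R -> R, is_solution x0 z0 k1 k2 v ->
       forall x, x \in `[0, x0] -> v x = u x) /\
    (* (i) *)
    (- Num.sqrt (1 + k1 ^+ 2) <= k1 + k2 <= Num.sqrt (1 + k2 ^+ 2) ->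
       [/\ two_slopes x0 u k1 k2,
           forall x, x \in `[0, x0] ->
             u x = Num.min (k1 * x) (z0 + k2 * (x - x0)) &
           graph_on x0 u = broken_line A C B]) /\
    (* (ii) *)
    (k1 <= - (1 / Num.sqrt 3) \/ k2 >= 1 / Num.sqrt 3 ->
       (forall x, x \in `[0, x0] -> u x = K0 * x) /\
       graph_on x0 u = segment A B) /\
    (* (iii) *)
    (k2 < 1 / Num.sqrt 3 -> k1 > Num.sqrt (1 + k2 ^+ 2) - k2 ->
       (k2 < K0 < Num.sqrt (1 + k2 ^+ 2) - k2 ->
          two_slopes x0 u (Num.sqrt (1 + k2 ^+ 2) - k2) k2 /\
          exists C'' : R * R,
            segment C B C'' /\ graph_on x0 u = broken_line A C'' B) /\
       (Num.sqrt (1 + k2 ^+ 2) - k2 <= K0 < k1 ->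
          forall x, x \in `[0, x0] -> u x = K0 * x)) /\
    (* (iv) *)
    (k1 > - (1 / Num.sqrt 3) -> k2 < - Num.sqrt (1 + k1 ^+ 2) - k1 ->
       (- Num.sqrt (1 + k1 ^+ 2) - k1 < K0 < k1 ->
          two_slopes x0 u k1 (- Num.sqrt (1 + k1 ^+ 2) - k1) /\
          exists C' : R * R,
            segment A C C' /\ graph_on x0 u = broken_line A C' B) /\
       (k2 < K0 <= - Num.sqrt (1 + k1 ^+ 2) - k1 ->
          forall x, x \in `[0, x0] -> u x = K0 * x)).
Proof.
have k21 : k2 < k1 := lt_trans hK2 hK1.
have z0E : z0 = K0 * x0 by rewrite hK0 divfK ?gt_eqF.
have sq_gt0 (k : R) : 0 < 1 + k ^+ 2 by rewrite ltr_pwDl// sqr_ge0.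
set s1 := Num.sqrt (1 + k1 ^+ 2); set s2 := Num.sqrt (1 + k2 ^+ 2).
have s1_gt0 : 0 < s1 by rewrite sqrtr_gt0.
have s2_gt0 : 0 < s2 by rewrite sqrtr_gt0.
have es1 : s1 ^+ 2 = 1 + k1 ^+ 2 by rewrite sqr_sqrtr ?(ltW (sq_gt0 _)).
have es2 : s2 ^+ 2 = 1 + k2 ^+ 2 by rewrite sqr_sqrtr ?(ltW (sq_gt0 _)).
set r := 1 / Num.sqrt 3.
have r_gt0 : 0 < r by rewrite divr_gt0// sqrtr_gt0.
have r2 : r ^+ 2 = 1 / 3 by rewrite /r expr_div_n expr1n sqr_sqrtr.
(* The threshold 1/sqrt 3 is the positive [k] at which sqrt (1 + k^2) equals [2 * k]: a square of at
   least 1/3 gives 1 + k^2 <= 4 k^2. *)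
have r_le (k s : R) : 0 < s -> s ^+ 2 = 1 + k ^+ 2 -> r <= k -> s <= 2 * k.
  move=> s_gt0 es rk; have k_gt0 := lt_le_trans r_gt0 rk.
  have : r ^+ 2 <= k ^+ 2 by rewrite ler_sqr ?nnegrE; lra.
  rewrite r2 => rk2; have : s ^+ 2 <= (2 * k) ^+ 2 by rewrite es; lra.
  by rewrite ler_sqr ?nnegrE; lra.
have F2 : r <= k2 -> s2 <= 2 * k2 by exact: r_le.
have F1 : k1 <= - r -> s1 <= - (2 * k1).
  by rewrite lerNr -mulrN => rk; apply: r_le rk; rewrite ?sqrrN.
clearbody s1 s2 r; clear r_le r2.
rewrite hA hB; clear hA hB A B.
case: C hAC hBC => C1 C2 /= hAC hBC.
have C1E : (k1 - k2) * C1 = z0 - k2 * x0 by lra.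
have straight (u : R -> R) : (forall x, x \in `[0, x0] -> u x = K0 * x) ->
    (forall x, x \in `[0, x0] -> u x = K0 * x) /\
    graph_on x0 u = segment (0, 0) (x0, z0).
  by move=> uE; split=> //; rewrite z0E; exact: (linear_graph hx0 uE).
(* Straight regime on the right: it contains (iii)(b) and, by [F2], the part of (ii) with
   [k2 >= r]. *)
have [RA|RA] := leP (s2 - k2) K0.
  have [us uu] := straight_right_solves hx0 hK0 hK2 hK1 s2_gt0 es2 RA.
  exists (roof x0 z0 K0 k2); split; [exact: us|split; [exact: uu|]].
  have uE x : x \in `[0, x0] -> roof x0 z0 K0 k2 x = K0 * x.
    rewrite in_itv/= => /andP[_ xx]; apply: roof_le_ridge => //.
    by rewrite ler_pdivlMr ?subr_gt0// z0E; nra.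
  split; first by move=> h; exfalso; lra.
  split; first by move=> _; exact: straight.
  split; first by move=> _ _; split=> [h|//]; exfalso; lra.
  by move=> h1 h2; exfalso; lra.
(* Straight regime on the left: it contains (iv)(b) and, by [F1], the part of (ii) with [k1 <= - r].
   Hence (ii) is impossible afterwards, which is [nii]. *)
have [RB|RB] := leP K0 (- s1 - k1).
  have [us uu] := straight_left_solves hx0 hK0 hK2 hK1 s1_gt0 es1 RB.
  exists (roof x0 z0 k1 K0); split; [exact: us|split; [exact: uu|]].
  have uE x : x \in `[0, x0] -> roof x0 z0 k1 K0 x = K0 * x.
    rewrite in_itv/= => /andP[x_ge0 _]; rewrite roof_ge_ridge//; first by rewrite z0E; ring.
    by rewrite ler_pdivrMr ?subr_gt0// z0E subrr mulr_ge0// subr_ge0 ltW.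
  split; first by move=> h; exfalso; lra.
  split; first by move=> _; exact: straight.
  split; first by move=> h1 h2; exfalso; lra.
  by move=> _ _; split=> [h|//]; exfalso; lra.
have nii : ~ (k1 <= - r \/ k2 >= r).
  by case=> [/F1|/F2] h; lra.
have [RD|RD] := ltP s2 (k1 + k2).
  have Pk : s2 - k2 <= k1 by lra.
  have QP : k2 < s2 - k2 := lt_trans hK2 RA.
  have [us uu] := tangent_right_solves hx0 hK0 hK2 s2_gt0 es2 RA Pk.
  exists (roof x0 z0 (s2 - k2) k2); split; [exact: us|split; [exact: uu|]].
  split; first by move=> h; exfalso; lra.
  split; first by move=> /nii.
  split; last by move=> h1 h2; exfalso; lra.
  move=> _ _; split=> [_|h]; last by exfalso; lra.
  split; first exact: (roof_two_slopes hx0 hK0 QP hK2 RA).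
  have qz : k2 * x0 < z0 by rewrite z0E ltr_pM2r.
  have zp : z0 < (s2 - k2) * x0 by rewrite z0E ltr_pM2r.
  set c := ridge x0 z0 (s2 - k2) k2.
  exists (c, (s2 - k2) * c); split; last exact: roof_graph.
  have c_gt0 : 0 < c by rewrite ridge_gt0.
  have c_lt : c < x0 by rewrite ridge_lt.
  have cE := ridgeE x0 z0 QP; rewrite -/c in cE.
  (* Both points lie on the line of slope [k2] through [B]; the line from [A] with the smaller slope
     [s2 - k2 <= k1] meets it further to the right. *)
  have C1c : C1 <= c.
    rewrite -(ler_pM2l (x := k1 - k2)) ?subr_gt0// C1E.
    have : 0 <= (k1 - (s2 - k2)) * c by rewrite mulr_ge0 ?(ltW c_gt0)// subr_ge0.
    by lra.
  have := @segment_affine R C1 x0 k2 (fun x => z0 + k2 * (x - x0)) (le_lt_trans C1c c_lt).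
  rewrite /= -hBC subrr mulr0 addr0 => ->; last by move=> x _; rewrite hBC; ring.
  by exists c; [rewrite /= in_itv/= C1c ltW|rewrite cE].
have [RE|RE] := ltP (k1 + k2) (- s1).
  have kQ : k2 <= - s1 - k1 by lra.
  have QP : - s1 - k1 < k1 := lt_trans RB hK1.
  have [us uu] := tangent_left_solves hx0 hK0 hK1 s1_gt0 es1 RB kQ.
  exists (roof x0 z0 k1 (- s1 - k1)); split; [exact: us|split; [exact: uu|]].
  split; first by move=> h; exfalso; lra.
  split; first by move=> /nii.
  split; first by move=> h1 h2; exfalso; lra.
  move=> _ _; split=> [_|h]; last by exfalso; lra.
  split; first exact: (roof_two_slopes hx0 hK0 QP RB hK1).
  have qz : (- s1 - k1) * x0 < z0 by rewrite z0E ltr_pM2r.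
  have zp : z0 < k1 * x0 by rewrite z0E ltr_pM2r.
  set c := ridge x0 z0 k1 (- s1 - k1).
  exists (c, k1 * c); split; last exact: roof_graph.
  have c_gt0 : 0 < c by rewrite ridge_gt0.
  have c_lt : c < x0 by rewrite ridge_lt.
  have cE := ridgeE x0 z0 QP; rewrite -/c in cE.
  (* Both points lie on the line of slope [k1] through [A]; the line through [B] with the larger
     slope [- s1 - k1 >= k2] meets it further to the left. *)
  have cC1 : c <= C1.
    rewrite -(ler_pM2l (x := k1 - k2)) ?subr_gt0// C1E.
    have : 0 <= ((- s1 - k1) - k2) * (x0 - c) by rewrite mulr_ge0// subr_ge0// ltW.
    by lra.
  have := @segment_affine R 0 C1 k1 (fun x => k1 * x) (lt_le_trans c_gt0 cC1).
  rewrite /= -hAC mulr0 => ->; last by move=> x _; ring.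
  by exists c => //=; rewrite in_itv/= (ltW c_gt0).
(* What remains is exactly the range of (i), where the ridge is the abscissa of [C]. *)
have hi : - s1 <= k1 + k2 <= s2 by rewrite RE.
have [us uu] := full_solves hx0 hK0 hK2 hK1 s1_gt0 s2_gt0 es1 es2 hi.
exists (roof x0 z0 k1 k2); split; [exact: us|split; [exact: uu|]].
split.
  move=> _; split=> //; first exact: (roof_two_slopes hx0 hK0 k21 hK2 hK1).
  rewrite roof_graph// ?z0E ?ltr_pM2r// -z0E.
  have -> : ridge x0 z0 k1 k2 = C1.
    by rewrite /ridge -C1E mulrAC divff ?mul1r// subr_eq0 gt_eqF.
  by rewrite -hAC.
split; first by move=> /nii.
by split=> h1 h2; exfalso; lra.
Qed.
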